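(* Suppose that the conditional distribution of $(X,H)$ given $Y=y$ has the density (with respect to Lebesgue measure on $\mathbb{R}^p$ times counting measure on $\{0,1\}^q$) $$f(x,h\mid y)=(2\pi)^{-p/2}\exp\{T(x,h)^T\eta_y-\psi(\eta_y)\}$$ with $T$, $\eta_y$, $\psi$ as defined in the context. Let $\alpha_a$ be a matrix whose columns form a basis of the subspace $\mathrm{span}\{\eta_Y-E(\eta_Y):\ Y\in\mathcal{Y}\}$. Then $$R(X,H)=\alpha_a^T\big(T(X,H)-E(T(X,H))\big)$$ is a minimal sufficient reduction for the regression of $Y$ on $(X,H)$.
   Context: Setting. $Y$ is a (continuous or categorical) random response with sample space $\mathcal{Y}$, $X$ is a random vector in $\mathbb{R}^p$, $H$ a random vector in $\{0,1\}^q$, $Z=(X^T,H^T)^T$. $f_Y\in\mathbb{R}^r$ is a known function of $Y$, centered so that $E(f_Y)=0$. All expectations written are assumed to exist. Matrix notation. $k_q=q(q-1)/2$, $m_p=p(p+1)/2$. $\mathrm{vec}$ stacks columns, $\mathrm{unvec}$ is its inverse (to a matrix of the size dictated by the context), $\mathrm{vech}$ stacks the columns of the lower triangular part including the diagonal. $D_q\in\mathbb{R}^{q^2\times q(q+1)/2}$ is the matrix with $\mathrm{vec}(G)=D_q\mathrm{vech}(G)$ for every symmetric $q\times q$ matrix $G$. $L_q\in\{0,1\}^{q\times q(q+1)/2}$ and $J_q\in\{0,1\}^{k_q\times q(q+1)/2}$ are the selection matrices extracting from $\mathrm{vech}(G)$ the diagonal entries, respectively the off-diagonal entries, of $G$ (in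 the order of $\mathrm{vech}$). Model. Parameters: $\Delta$ a $p\times p$ positive definite matrix, $A\in\mathbb{R}^{p\times r}$, $\beta\in\mathbb{R}^{p\times q}$, $\mu_X=E(X)$, $\mu_H=E(H)$, $\tau_0\in\mathbb{R}^{q(q+1)/2}$, $\tau\in\mathbb{R}^{q(q+1)/2\times r}$. The conditional law of $(X,H)$ given $Y=y$ is: $X\mid(H,Y=y)\sim N(\mu_X+Af_y+\beta(H-\mu_H),\Delta)$ and $P(H=h\mid Y=y)=G_y^{-1}\exp\{\mathrm{vech}(hh^T)^T(\tau_0+\tau f_y)\}$, $h\in\{0,1\}^q$, with $G_y=\sum_{h\in\{0,1\}^q}\exp\{\mathrm{vech}(hh^T)^T(\tau_0+\tau f_y)\}$. Its density can be written in the exponential family form of the claim, with $$T(X,H)=\big(X^T,\ H^T,\ [-\tfrac12D_p^TD_p\mathrm{vech}(XX^T)]^T,\ \mathrm{vec}(XH^T)^T,\ [J_q\mathrm{vech}(HH^T)]^T\big)^T,$$ $\eta_y=(\eta_{y1}^T,\eta_{y2}^T,\eta_{y3}^T,\eta_{y4}^T,\eta_{y5}^T)^T$, $\eta_{y1}=\Delta^{-1}\mu_X-\Delta^{-1}\beta\mu_H+\Delta^{-1}Af_y$, $\eta_{y2}=-\beta^T\Delta^{-1}\mu_X+\beta^T\Delta^{-1}\beta\mu_H+L_q\tau_0-\tfrac12L_qD_q^T\mathrm{vec}(\beta^T\Delta^{-1}\beta)+(L_q\tau-\beta^T\Delta^{-1}A)f_y$, $\eta_{y3}=\mathrm{vech}(\Delta^{-1})$,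 $\eta_{y4}=\mathrm{vec}(\Delta^{-1}\beta)$, $\eta_{y5}=-\tfrac12J_qD_q^T\mathrm{vec}(\beta^T\Delta^{-1}\beta)+J_q\tau_0+J_q\tau f_y$, and $\psi(\eta_y)$ the log-normalizing constant. Definitions. A function $R$ of $Z$ is a sufficient reduction for the regression of $Y$ on $Z$ if the conditional distribution of $Y$ given $Z$ equals that of $Y$ given $R(Z)$ (equivalently, $Z\mid(Y,R(Z))$ has the same distribution as $Z\mid R(Z)$, i.e. $R(Z)$ is a sufficient statistic when $Y$ is regarded as a parameter). It is minimal if it is (almost surely) a function of every other sufficient reduction. The span in the claim is understood up to null sets of $Y$: it is the smallest linear subspace containing $\eta_Y-E(\eta_Y)$ almost surely. *)

(* Defs.v *)
From HB Require Import structures.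
From mathcomp Require Import all_boot all_order all_algebra.
From mathcomp Require Import all_classical all_reals all_analysis.
Set Implicit Arguments.
Unset Strict Implicit.
Unset Printing Implicit Defensive.
Import Order.TTheory GRing.Theory Num.Theory.
Import numFieldNormedType.Exports.
Local Open Scope classical_set_scope.
Local Open Scope ring_scope.

(* The product sigma-algebra on matrices: the one generated by the entries. *)
Definition measure_mx_display : measure_display -> measure_display.
Proof. exact. Qed.

Section measurable_matrix.
Context {d} {T : measurableType d} (m n : nat).

Definition mx_cylinders : set (set 'M[T]_(m, n)) :=
  [set C | exists i j, exists2 B : set T,
    measurable B & C = (fun M : 'M[T]_(m, n) => M i j) @^-1` B].

Let mx_set0 : <<s mx_cylinders >> set0.
Proof. exact: sigma_algebra0. Qed.

Let mx_setC C : <<s mx_cylinders >> C -> <<s mx_cylinders >> (~` C).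
Proof. exact: sigma_algebraC. Qed.

Let mx_bigcup (F : (set 'M[T]_(m, n))^nat) :
  (forall i, <<s mx_cylinders >> (F i)) ->
  <<s mx_cylinders >> (\bigcup_i F i).
Proof. exact: sigma_algebra_bigcup. Qed.

HB.instance Definition _ := @isMeasurable.Build (measure_mx_display d)
  'M[T]_(m, n) <<s mx_cylinders >> mx_set0 mx_setC mx_bigcup.

Lemma measurable_mx_entry i j :
  measurable_fun [set: 'M[T]_(m, n)] (fun M : 'M[T]_(m, n) => M i j).
Proof.
move=> _ B mB; rewrite setTI; apply: sub_sigma_algebra.
by exists i, j; exists B.
Qed.

Lemma measurable_fun_mx d' (T' : measurableType d') (g : T' -> 'M[T]_(m, n)) :
  (forall i j, measurable_fun setT (fun t => g t i j)) -> measurable_fun setT g.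
Proof.
move=> mg; apply: (measurability mx_cylinders) => //.
move=> _ [_ [i [j [B mB ->]]] <-]; rewrite setTI.
by rewrite -[X in measurable X]setTI; exact: mg.
Qed.

End measurable_matrix.

Section lebesgue_measure_cV.
Context {R : realType}.

Definition cons_cV n (xv : R * 'cV[R]_n) : 'cV[R]_(1 + n) :=
  col_mx (const_mx xv.1) xv.2.

Lemma measurable_cons_cV n : measurable_fun setT (@cons_cV n).
Proof.
apply: measurable_fun_mx => i j; rewrite /cons_cV.
case: (split_ordP i) => k ->.
  rewrite (_ : (fun _ => _) = fst) ?measurable_fst//.
  by apply/funext => -[x v]; rewrite col_mxEu mxE.
rewrite (_ : (fun _ => _) = (fun M : 'cV[R]_n => M k j) \o snd); last first.
  by apply/funext => -[x v]; rewrite /= col_mxEd.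
by apply: measurableT_comp => //; exact: measurable_mx_entry.
Qed.

Section lebesgue_cons.
Variables (n : nat) (mu : {measure set 'cV[R]_n -> \bar R}).

Definition lebesgue_cons : set 'cV[R]_(1 + n) -> \bar R :=
  pushforward (lebesgue_measure \x^ mu)%E (@cons_cV n).

Let lebesgue_cons0 : lebesgue_cons set0 = 0%E.
Proof. by apply: measure0; exact: measurable_cons_cV. Qed.

Let lebesgue_cons_ge0 A : (0 <= lebesgue_cons A)%E.
Proof. by apply: measure_ge0; exact: measurable_cons_cV. Qed.

Let lebesgue_cons_sigma_additive : semi_sigma_additive lebesgue_cons.
Proof.
by apply: measure_semi_sigma_additive; exact: measurable_cons_cV.
Qed.

HB.instance Definition _ := isMeasure.Build _ _ _ lebesgue_cons
  lebesgue_cons0 lebesgue_cons_ge0 lebesgue_cons_sigma_additive.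

End lebesgue_cons.

Fixpoint lebesgue_cV n : {measure set 'cV[R]_n -> \bar R} :=
  match n with
  | 0 => \d_(0 : 'cV[R]_0)
  | n'.+1 => lebesgue_cons (lebesgue_cV n')
  end.

Lemma lebesgue_cV_box n (A : 'I_n -> set R) : (forall i, measurable (A i)) ->
  lebesgue_cV n [set v | forall i, A i (v i 0)] =
  (\prod_(i < n) lebesgue_measure (A i))%E.
Proof.
elim: n A => [|n IH] A mA.
  by rewrite big_ord0 /= diracE mem_set// => -[].
rewrite big_ord_recl -(IH (fun i => A (lift ord0 i)))//=.
have mB : measurable [set v : 'cV[R]_n | forall i, A (lift ord0 i) (v i 0)].
  rewrite (_ : mkset _ =
    \bigcap_(i in [set: 'I_n]) [set v : 'cV[R]_n | A (lift ord0 i) (v i 0)]).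
    apply: fin_bigcap_measurable => // i _.
    rewrite -[X in measurable X]setTI.
    exact: (measurable_mx_entry i 0).
  by apply/seteqP; split => v /= h i => [_|]; apply: h.
rewrite -product_measure2E; [|exact: (mA ord0)|exact: mB].
rewrite /lebesgue_cons /pushforward; congr product_measure2.
have e0 x (v : 'cV[R]_n) : cons_cV (x, v) ord0 0 = x :> R.
  transitivity (cons_cV (x, v) (lshift n (ord0 : 'I_1)) 0).
    by congr (cons_cV _ _ _); exact/val_inj.
  by rewrite col_mxEu mxE.
have eS x (v : 'cV[R]_n) (i : 'I_n) : cons_cV (x, v) (lift ord0 i) 0 = v i 0 :> R.
  transitivity (cons_cV (x, v) (rshift 1 i) 0).
    by congr (cons_cV _ _ _); exact/val_inj.
  by rewrite col_mxEd.
apply/seteqP; split => -[x v] /=.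
  by move=> h; split => [|i]; [rewrite -(e0 x v)|rewrite -(eS x)].
move=> [h0 h] i; case: (unliftP ord0 i) => [j ->|->].
  by rewrite eS.
by rewrite e0.
Qed.

End lebesgue_measure_cV.

Section vectorization.
Context {R : realType}.

Definition vec m n (M : 'M[R]_(m, n)) : 'cV[R]_(n * m) := (mxvec M^T)^T.

Definition mdim n := (n * n.+1)./2.
Definition kdim n := (n * n.-1)./2.

(* Positions are pairs (column, row), enumerated column by column. *)
Definition low n := [pred ji : 'I_n * 'I_n | (ji.1 <= ji.2)%N].
Definition slow n := [pred ji : 'I_n * 'I_n | (ji.1 < ji.2)%N].

Lemma card_slow n : #|slow n| = kdim n.
Proof.
transitivity (\sum_(i < n) \sum_(j < n | (j < i)%N) 1)%N.
  rewrite -sum1_card (exchange_big_dep xpredT)//= pair_big_dep.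
  by apply: eq_bigl => -[j i]; rewrite inE.
transitivity (\sum_(i < n) i)%N.
  apply: eq_bigr => i _.
  by rewrite -(big_ord_widen n (fun=> 1%N)) ?sum1_card ?card_ord// ltnW.
by rewrite -(big_mkord xpredT id) bin2_sum bin2.
Qed.

Lemma card_low n : #|low n| = mdim n.
Proof.
transitivity (\sum_(i < n) \sum_(j < n | (j < i.+1)%N) 1)%N.
  rewrite -sum1_card (exchange_big_dep xpredT)//= pair_big_dep.
  by apply: eq_bigl => -[j i]; rewrite inE.
transitivity (\sum_(i < n) i.+1)%N.
  apply: eq_bigr => i _.
  by rewrite -(big_ord_widen n (fun=> 1%N)) ?sum1_card ?card_ord.
transitivity (\sum_(i < n.+1) i)%N; first by rewrite big_ord_recl.
by rewrite -(big_mkord xpredT id) bin2_sum bin2 mulnC.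
Qed.

Definition low_pos n (k : 'I_(mdim n)) : 'I_n * 'I_n :=
  enum_val (cast_ord (esym (card_low n)) k).

Definition slow_pos n (k : 'I_(kdim n)) : 'I_n * 'I_n :=
  enum_val (cast_ord (esym (card_slow n)) k).

Definition vech n (G : 'M[R]_n) : 'cV[R]_(mdim n) :=
  \col_k G (low_pos k).2 (low_pos k).1.

(* Column k is vec of the symmetric 0/1 matrix supported on position k and its
   transpose; see vec_dup for the defining property. *)
Definition dup_mx n : 'M[R]_(n * n, mdim n) :=
  \matrix_(a, k) vec (\matrix_(i, j)
    ((low_pos k == (j, i)) || (low_pos k == (i, j)))%:R : 'M[R]_n) a 0.

Lemma vec_dup n (G : 'M[R]_n) : G^T = G -> vec G = dup_mx n *m vech G.
Proof.
move=> symG; apply/matrixP => a b; rewrite !mxE ord1 {b}.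
case/mxvec_indexP: a => j i; rewrite mxvecE mxE.
pose ji := if (j <= i)%N then (j, i) else (i, j).
have lowji : ji \in low n.
  by rewrite /ji inE; case: ifPn => //=; rewrite -ltnNge => /ltnW.
pose k0 := cast_ord (card_low n) (enum_rank_in lowji ji).
have k0E : low_pos k0 = ji by rewrite /low_pos cast_ordK enum_rankK_in.
have low_posP (k : 'I_(mdim n)) : low_pos k \in low n by exact: enum_valP.
have inj : injective (@low_pos n).
  by move=> k l /enum_val_inj /cast_ord_inj.
rewrite (bigD1 k0)//= big1 ?addr0 => [|k kk0].
  rewrite !mxE mxvecE !mxE k0E /ji; case: ifP => _ /=.
    by rewrite eqxx mul1r.
  by rewrite eqxx orbT mul1r -[in RHS]symG mxE.
rewrite !mxE mxvecE !mxE; case: orP => [ek|_]; last by rewrite mul0r.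
case/negP: kk0; rewrite -(inj_eq inj) k0E /ji.
have := low_posP k; rewrite inE.
case: ek => /eqP -> /=; first by move->.
by case: (ltngtP j i) => //= /val_inj ->.
Qed.

Definition diag_sel n : 'M[R]_(n, mdim n) :=
  \matrix_(i, k) (low_pos k == (i, i))%:R.

Definition offdiag_sel n : 'M[R]_(kdim n, mdim n) :=
  \matrix_(l, k) (low_pos k == slow_pos l)%:R.

End vectorization.

Definition sdim p q := (p + (q + (mdim p + (q * p + kdim q))))%N.

Section mixed_family.
Context {R : realType} {p q r : nat}.

Definition boolcV (h : 'cV[bool]_q) : 'cV[R]_q := map_mx (fun b : bool => b%:R) h.

Definition posdefmx n (M : 'M[R]_n) : Prop :=
  M^T = M /\ forall v : 'cV[R]_n, v != 0 -> 0 < (v^T *m M *m v) 0 0.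

Definition suffstat (x : 'cV[R]_p) (hb : 'cV[bool]_q) : 'cV[R]_(sdim p q) :=
  let h := boolcV hb in
  col_mx x
 (col_mx h
 (col_mx (- 2^-1 *: ((dup_mx p)^T *m dup_mx p *m vech (x *m x^T)))
 (col_mx (vec (x *m h^T))
         (offdiag_sel q *m vech (h *m h^T))))).

Variables (Delta : 'M[R]_p) (A : 'M[R]_(p, r)) (beta : 'M[R]_(p, q)).
Variables (muX : 'cV[R]_p) (muH : 'cV[R]_q).
Variables (tau0 : 'cV[R]_(mdim q)) (tau : 'M[R]_(mdim q, r)).

(* The natural parameter at f_y = f. *)
Definition natparam (f : 'cV[R]_r) : 'cV[R]_(sdim p q) :=
  let Di := invmx Delta in
  let B := beta^T *m Di *m beta in
  col_mx (Di *m muX - Di *m beta *m muH + Di *m A *m f)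
 (col_mx (- (beta^T *m Di *m muX) + B *m muH + diag_sel q *m tau0
          - 2^-1 *: (diag_sel q *m (dup_mx q)^T *m vec B)
          + (diag_sel q *m tau - beta^T *m Di *m A) *m f)
 (col_mx (vech Di)
 (col_mx (vec (Di *m beta))
         (- 2^-1 *: (offdiag_sel q *m (dup_mx q)^T *m vec B)
          + offdiag_sel q *m tau0 + offdiag_sel q *m tau *m f)))).

(* (2 pi)^(- p / 2) exp(T(x, h)^T eta): the density before normalization. *)
Definition unnorm_density (eta : 'cV[R]_(sdim p q)) (x : 'cV[R]_p) (h : 'cV[bool]_q) :
    R :=
  (2 * pi) `^ (- (p%:R / 2)) * expR (((suffstat x h)^T *m eta) 0 0).

(* The log-normalizing constant psi: it makes the density integrate to 1
   against Lebesgue measure times counting measure. *)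
Definition log_partition (eta : 'cV[R]_(sdim p q)) : R :=
  ln (fine (\sum_(h : 'cV[bool]_q)
    \int[lebesgue_cV p]_x (unnorm_density eta x h)%:E)%E).

Definition expfam_density (eta : 'cV[R]_(sdim p q)) (x : 'cV[R]_p) (h : 'cV[bool]_q) :
    R :=
  (2 * pi) `^ (- (p%:R / 2)) *
  expR (((suffstat x h)^T *m eta) 0 0 - log_partition eta).

End mixed_family.

Section random_vectors.
Context {d} {Omega : measurableType d} {R : realType} (P : probability Omega R).

Definition has_mean n (V : Omega -> 'cV[R]_n) : Prop :=
  forall i, P.-integrable setT (fun w => (V w i ord0)%:E).

Definition mean n (V : Omega -> 'cV[R]_n) : 'cV[R]_n :=
  \col_i fine ('E_P[fun w => V w i ord0])%E.

(* S is the smallest linear subspace containing V almost surely. *)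
Definition is_ae_span n (V : Omega -> 'cV[R]_n) (S : {vspace 'cV[R]_n}) : Prop :=
  {ae P, forall w, V w \in S} /\
  forall S' : {vspace 'cV[R]_n}, {ae P, forall w, V w \in S'} -> (S <= S')%VS.

(* f y is a density of the conditional law of (X, H) given Y = y, with respect
   to Lebesgue measure times counting measure. *)
Definition has_cond_density {dY} {Yt : measurableType dY} {p q : nat}
    (Y : {RV P >-> Yt}) (X : {RV P >-> 'cV[R]_p}) (H : {RV P >-> 'cV[bool]_q})
    (f : Yt -> 'cV[R]_p -> 'cV[bool]_q -> R) : Prop :=
  forall (C : set Yt) (B : set ('cV[R]_p * 'cV[bool]_q)),
    measurable C -> measurable B ->
    P [set w | C (Y w) /\ B (X w, H w)] =
    (\int[distribution P Y]_(y in C) \sum_(h : 'cV[bool]_q)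
       \int[lebesgue_cV p]_(x in [set x | B (x, h)]) (f y x h)%:E)%E.

(* g is a version of the conditional probability P(E | W), as a function of the
   value of W. *)
Definition is_cond_prob {dW} {TW : measurableType dW} (W : Omega -> TW)
    (E : set Omega) (g : TW -> R) : Prop :=
  measurable_fun setT g /\
  forall B : set TW, measurable B ->
    P (E `&` W @^-1` B) = (\int[P]_(w in W @^-1` B) (g (W w))%:E)%E.

(* The conditional law of Y given Z equals that of Y given rho(Z): conditional
   probabilities of every event {Y \in C} agree almost surely. *)
Definition sufficient_reduction {dY dZ dT} {Yt : measurableType dY}
    {TZ : measurableType dZ} {T : measurableType dT}
    (Y : Omega -> Yt) (Z : Omega -> TZ) (rho : TZ -> T) : Prop :=
  measurable_fun setT rho /\
  forall C : set Yt, measurable C ->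
    exists (g : TZ -> R) (k : T -> R),
      [/\ is_cond_prob Z (Y @^-1` C) g,
          is_cond_prob (rho \o Z) (Y @^-1` C) k &
          {ae P, forall w, g (Z w) = k (rho (Z w))}].

Definition minimal_sufficient_reduction {dY dZ dT} {Yt : measurableType dY}
    {TZ : measurableType dZ} {T : measurableType dT}
    (Y : Omega -> Yt) (Z : Omega -> TZ) (rho : TZ -> T) : Prop :=
  sufficient_reduction Y Z rho /\
  forall dT' (T' : measurableType dT') (rho' : TZ -> T'),
    sufficient_reduction Y Z rho' ->
    exists2 phi : T' -> T, measurable_fun setT phi &
      {ae P, forall w, rho (Z w) = phi (rho' (Z w))}.

End random_vectors.

(* Main.v *)
(** Let [S] be the span of the centred natural parameter, with basis [alpha].
    Almost surely [eta_Y - E eta_Y = alpha c_Y], so the density of [Z = (X, H)]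
    given [Y = y] is [h0 z * b y * exp (c_y^T R z)] with [R] the proposed
    reduction: Bayes' formula makes the posterior probability of any event
    [Y \in C] a function of [R Z].

    For minimality let [R'] be a sufficient reduction, so that all posterior
    probabilities are almost surely functions of [R' Z].  On a small cell [C]
    around a point [y], the posterior of [C] at [z] is proportional, up to a
    factor close to 1 and relative to a fixed reference point, to
    [exp (c_y^T R z)] times a quantity not depending on the cell; hence
    [(c_y - c_y0)^T R Z] is a limit of functions of [R' Z].  The vectors [v]
    such that [v^T R Z] is a function of [R' Z] form a subspace containing
    [c_Y - c_y0] almost surely, hence also its mean [- c_y0] and [c_Y]; since
    [S] is the smallest subspace, it is everything. *)
Require Import Defs.
From HB Require Import structures.
From mathcomp Require Import all_boot all_order all_algebra.
From mathcomp Require Import all_classical all_reals all_analysis.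
From mathcomp Require Import measurable_realfun ring lra.
Set Implicit Arguments.
Unset Strict Implicit.
Unset Printing Implicit Defensive.
Import Order.TTheory GRing.Theory Num.Theory.
Import numFieldNormedType.Exports.
Local Open Scope classical_set_scope.
Local Open Scope ring_scope.

(** * Tonelli on rectangles, and integrals against a density *)

Section partial_integral.
Local Open Scope ereal_scope.
Context d1 d2 (T1 : measurableType d1) (T2 : measurableType d2) (R : realType).
Variable mu : {sigma_finite_measure set T1 -> \bar R}.

Lemma measurable_partial_integral (K : T1 * T2 -> \bar R) (C : set T1) :
  measurable C -> measurable_fun setT K -> (forall u, 0 <= K u) ->
  measurable_fun setT (fun t => \int[mu]_(y in C) K (y, t)).
Proof.
move=> mC mK K0.
rewrite (_ : (fun _ => _) = fubini_G mu (fun u => K u * (\1_C u.1)%:E)).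
  apply: measurable_fun_fubini_tonelli_G.
    apply: emeasurable_funM => //; apply/measurable_EFinP.
    by apply: measurableT_comp => //; exact: measurable_indic.
  by move=> u; rewrite mule_ge0 ?K0// lee_fin.
by apply/funext => t; rewrite integral_mkcond epatch_indic.
Qed.

(** Both restrictions are absorbed into the kernel as indicator factors, which reduces the exchange
    to Tonelli on the whole product. *)
Lemma fubini_tonelli_in (nu : {sigma_finite_measure set T2 -> \bar R})
    (K : T1 * T2 -> \bar R) (C : set T1) (B : set T2) :
  measurable C -> measurable B -> measurable_fun setT K -> (forall u, 0 <= K u) ->
  \int[mu]_(y in C) \int[nu]_(z in B) K (y, z) =
  \int[nu]_(z in B) \int[mu]_(y in C) K (y, z).
Proof.
move=> mC mB mK K0.
have m1C : measurable_fun setT (fun u : T1 * T2 => (\1_C u.1)%:E : \bar R).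
  by apply/measurable_EFinP; apply: measurableT_comp => //; exact: measurable_indic.
have m1B : measurable_fun setT (fun u : T1 * T2 => (\1_B u.2)%:E : \bar R).
  by apply/measurable_EFinP; apply: measurableT_comp => //; exact: measurable_indic.
pose F u := K u * (\1_C u.1)%:E * (\1_B u.2)%:E.
have F0 u : 0 <= F u by rewrite !mule_ge0 ?lee_fin.
have := @fubini_tonelli _ _ _ _ _ mu nu F.
move=> /(_ _ F0) /=.
have -> : \int[mu]_x \int[nu]_y F (x, y) =
    \int[mu]_(y in C) \int[nu]_(z in B) K (y, z).
  rewrite [RHS]integral_mkcond epatch_indic; apply: eq_integral => y _.
  rewrite [in RHS]integral_mkcond epatch_indic -ge0_integralZr ?lee_fin//; last first.
  - by move=> z _; rewrite mule_ge0 ?K0 ?lee_fin.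
  - apply: emeasurable_funM; first exact: measurableT_comp.
    by apply/measurable_EFinP; exact: measurable_indic.
  by apply: eq_integral => z _; rewrite /F /= -!muleA; congr (_ * _); rewrite muleC.
have -> : \int[nu]_y \int[mu]_x F (x, y) =
    \int[nu]_(z in B) \int[mu]_(y in C) K (y, z).
  rewrite [RHS]integral_mkcond epatch_indic; apply: eq_integral => z _.
  rewrite [in RHS]integral_mkcond epatch_indic -ge0_integralZr ?lee_fin//.
  - apply: emeasurable_funM; first exact: measurableT_comp.
    by apply/measurable_EFinP; exact: measurable_indic.
  - by move=> y _; rewrite mule_ge0 ?K0 ?lee_fin.
apply.
by apply: emeasurable_funM => //; exact: emeasurable_funM.
Qed.

End partial_integral.

(** [D] agrees [nu]-almost everywhere with the Radon-Nikodym derivative of [la], as both have the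
    same integrals over measurable sets; the change of variables for the derivative then carries
    over to [D]. *)
Lemma integral_density d (T : measurableType d) (R : realType)
    (la : {finite_measure set T -> \bar R})
    (nu : {sigma_finite_measure set T -> \bar R}) (D g : T -> \bar R) (B : set T) :
  measurable_fun setT D -> (forall x, 0 <= D x)%E ->
  (forall B, measurable B -> la B = \int[nu]_(x in B) D x)%E ->
  measurable B -> measurable_fun setT g -> (forall x, 0 <= g x)%E ->
  (\int[la]_(x in B) g x = \int[nu]_(x in B) (g x * D x))%E.
Proof.
move=> mD D0 laE mB mg g0.
have lanu : la `<< nu.
  apply/null_content_dominatesP => A mA nuA0; rewrite laE//.
  by rewrite null_set_integral//; exact: measurable_funTS.
rewrite -(Radon_Nikodym_SigmaFinite.change_of_variables lanu)//; last first.
  exact: measurable_funTS.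
apply: ae_eq_integral => //.
- apply: emeasurable_funM; first exact: measurable_funTS.
  exact/measurable_funTS/(measurable_int _ (Radon_Nikodym_SigmaFinite.f_integrable lanu)).
- by apply: emeasurable_funM; exact: measurable_funTS.
apply: ae_eqe_mul2l; apply: integral_ae_eq => //.
- apply: (integrableS measurableT) => //.
  exact: Radon_Nikodym_SigmaFinite.f_integrable.
- exact: measurable_funTS.
- by move=> E EB mE; rewrite -laE// -Radon_Nikodym_SigmaFinite.f_integral.
Qed.

Lemma integral_gt0 d (T : measurableType d) (R : realType)
    (mu : {measure set T -> \bar R}) (C : set T) (g : T -> \bar R) :
  measurable C -> measurable_fun C g -> (forall x, C x -> 0 < g x)%E ->
  (0 < mu C)%E -> (0 < \int[mu]_(x in C) g x)%E.
Proof.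
move=> mC mg g0 muC.
have g0' x : C x -> (0 <= g x)%E by move=> /g0/ltW.
rewrite lt0e integral_ge0// andbT; apply/eqP => ig0.
have /(ae_eq_integral_abs mu mC mg)[N [mN N0 CN]] :
    (\int[mu]_(x in C) `|g x| = 0)%E.
  by rewrite -[RHS]ig0; apply: eq_integral => x /set_mem/g0' ?; rewrite gee0_abs.
move: muC; rewrite lt0e => /andP[/eqP + _]; apply.
apply: (subset_measure0 mC mN) => // x Cx; apply: CN => /= /(_ Cx) gx0.
by have := g0 _ Cx; rewrite gx0 ltxx.
Qed.

(** * Bayes' formula and sufficiency for a factorized density *)

Section factorized_density.
Context d dY dZ dT (Omega : measurableType d) (R : realType)
  (P : probability Omega R) (TY : measurableType dY) (TZ : measurableType dZ)
  (T : measurableType dT) (Y : {RV P >-> TY}) (Z : {RV P >-> TZ}).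
Variables (nu : {sigma_finite_measure set TZ -> \bar R}).
Variables (h0 : TZ -> R) (K : TY * T -> R) (rho : TZ -> T).
Hypotheses (mh0 : measurable_fun setT h0) (h0_gt0 : forall z, 0 < h0 z).
Hypotheses (mK : measurable_fun setT K) (K_gt0 : forall u, 0 < K u).
Hypothesis mrho : measurable_fun setT rho.
Hypothesis joint : forall C B, measurable C -> measurable B ->
  P (Y @^-1` C `&` Z @^-1` B) =
  (\int[distribution P Y]_(y in C) \int[nu]_(z in B)
     (h0 z * K (y, rho z))%:E)%E.

(** Up to the factor [h0 z], this is the density of [Z] at [z] on the event that [Y] lies in [C],
    where [t = rho z]. It may be infinite, hence the extended real values. *)
Definition weight C t := (\int[distribution P Y]_(y in C) (K (y, t))%:E)%E.

(** Bayes' formula: the common factor [h0 z] has cancelled, so only [t = rho z] remains. Where the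
    total weight is infinite, [fine] makes the quotient 0; this happens with probability zero. *)
Definition posterior C t := fine (weight C t) / fine (weight setT t).

Lemma weight_ge0 C t : (0 <= weight C t)%E.
Proof. by apply: integral_ge0 => y _; rewrite lee_fin ltW. Qed.

Lemma measurable_weight C : measurable C -> measurable_fun setT (weight C).
Proof.
move=> mC.
apply: (@measurable_partial_integral _ _ _ _ _ _ (EFin \o K)) => //.
  exact/measurable_EFinP.
by move=> u; rewrite lee_fin ltW.
Qed.

Lemma measurable_K1 t : measurable_fun setT (fun y => (K (y, t))%:E : \bar R).
Proof. by apply/measurable_EFinP; exact: measurableT_comp. Qed.

Lemma weight_gt0 C t : measurable C -> (0 < P (Y @^-1` C))%E ->
  (0 < weight C t)%E.
Proof.
move=> mC PC; apply: integral_gt0 => //.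
- by apply: measurable_funTS; exact: measurable_K1.
- by move=> y _; rewrite lte_fin.
Qed.

Lemma weightT_gt0 t : (0 < weight setT t)%E.
Proof. by apply: weight_gt0 => //; rewrite preimage_setT probability_setT. Qed.

Lemma le_weight C t : measurable C -> (weight C t <= weight setT t)%E.
Proof.
move=> mC; apply: ge0_subset_integral => //; first exact: measurable_K1.
by move=> y _; rewrite lee_fin ltW.
Qed.

Lemma measurable_posterior C : measurable C -> measurable_fun setT (posterior C).
Proof.
move=> mC; apply: measurable_funM.
  by apply: measurableT_comp => //; exact: measurable_weight.
(* The inverse becomes a power with exponent -1, to which measurability of real powers applies. *)
under eq_fun do rewrite -powR_inv1 ?fine_ge0 ?weight_ge0//.
apply: (measurableT_comp (measurable_powR _)).
by apply: measurableT_comp => //; exact: measurable_weight.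
Qed.

Lemma posterior_ge0 C t : 0 <= posterior C t.
Proof. by rewrite divr_ge0// fine_ge0// weight_ge0. Qed.

Lemma posteriorE C t : measurable C -> weight setT t \is a fin_num ->
  ((posterior C t)%:E * weight setT t)%E = weight C t.
Proof.
move=> mC wT; have wC : weight C t \is a fin_num.
  rewrite ge0_fin_numE ?weight_ge0//.
  by rewrite (le_lt_trans (le_weight t mC))// -ge0_fin_numE ?weight_ge0.
rewrite -[in RHS](fineK wC) -[in LHS](fineK wT) -EFinM; congr EFin.
rewrite /posterior divfK// gt_eqF// fine_gt0// weightT_gt0/=.
by rewrite -ge0_fin_numE ?weight_ge0.
Qed.

Lemma jointE C B : measurable C -> measurable B ->
  P (Y @^-1` C `&` Z @^-1` B) =
  (\int[nu]_(z in B) (weight C (rho z) * (h0 z)%:E))%E.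
Proof.
move=> mC mB; rewrite joint//.
pose F (u : TY * TZ) : \bar R := (h0 u.2 * K (u.1, rho u.2))%:E.
have mF : measurable_fun setT F.
  apply/measurable_EFinP; apply: measurable_funM; first exact: measurableT_comp.
  apply: measurableT_comp => //; apply: measurable_fun_pair => //.
  exact: measurableT_comp.
have F0 u : (0 <= F u)%E by rewrite lee_fin mulr_ge0 ?ltW.
rewrite -[LHS]/(\int[distribution P Y]_(y in C) \int[nu]_(z in B) F (y, z))%E.
rewrite fubini_tonelli_in//.
apply: eq_integral => z _; rewrite /F/= muleC -ge0_integralZl ?lee_fin//.
- by apply: measurable_funTS; exact: measurable_K1.
- by move=> y _; rewrite lee_fin ltW.
- exact: ltW.
Qed.

Let D z := (weight setT (rho z) * (h0 z)%:E)%E.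

Let mD : measurable_fun setT D.
Proof.
apply: emeasurable_funM; last exact/measurable_EFinP.
by apply: measurableT_comp => //; exact: measurable_weight.
Qed.

Let D_ge0 z : (0 <= D z)%E.
Proof. by rewrite mule_ge0 ?weight_ge0// lee_fin ltW. Qed.

Let lawZ B : measurable B -> distribution P Z B = (\int[nu]_(z in B) D z)%E.
Proof.
by move=> mB; rewrite -jointE// preimage_setT setTI.
Qed.

(** The density [D] of [Z] has integral 1, hence is finite [nu]-almost everywhere; as [h0] is
    positive, an infinite weight would make [D] infinite. *)
Let weight_fin_nu : {ae nu, forall z, weight setT (rho z) \is a fin_num}.
Proof.
have : {ae nu, forall z, setT z -> D z \is a fin_num}.
  apply: integrable_ae => //; apply/integrableP; split => //.
  under eq_integral do rewrite gee0_abs//.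
  by rewrite -lawZ// probability_setT ltry.
apply: filterS => z /(_ I); rewrite !ge0_fin_numE ?weight_ge0// /D.
move: (weight_ge0 setT (rho z)); move: (weight _ _) => [x| |]// _.
  by move=> _; rewrite ltry.
by rewrite gt0_mulye// lte_fin.
Qed.

Lemma ae_preimage (Q : TZ -> Prop) :
  {ae distribution P Z, forall z, Q z} -> {ae P, forall w, Q (Z w)}.
Proof.
case=> N [mN N0 QN]; exists (Z @^-1` N); split => //.
- by rewrite -[_ @^-1` _]setTI; exact: measurable_funPT.
- by move=> w /= nQ; exact: QN.
Qed.

Lemma ae_weight_fin : {ae P, forall w, weight setT (rho (Z w)) \is a fin_num}.
Proof.
apply: (@ae_preimage (fun z => weight setT (rho z) \is a fin_num)).
have [N [mN N0 QN]] := weight_fin_nu; exists N; split => //.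
rewrite lawZ//; apply: null_set_integral => //; exact: measurable_funTS.
Qed.

(** Multiplying the posterior by the density [D] of [Z] gives back the density of [Z] on the event,
    wherever the total weight is finite. *)
Lemma cond_prob_posterior C : measurable C ->
  is_cond_prob P Z (Y @^-1` C) (posterior C \o rho).
Proof.
move=> mC; have mg : measurable_fun setT (posterior C \o rho).
  by apply: measurableT_comp => //; exact: measurable_posterior.
split => // B mB; rewrite jointE//.
transitivity (\int[distribution P Z]_(z in B) ((posterior C \o rho) z)%:E)%E.
  rewrite (integral_density mD D_ge0 lawZ)//; last first.
  - by move=> z; rewrite lee_fin posterior_ge0.
  - exact/measurable_EFinP.
  apply: ae_eq_integral => //.
  - apply: measurable_funTS; apply: emeasurable_funM; last exact/measurable_EFinP.
    by apply: measurableT_comp => //; exact: measurable_weight.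
  - apply: measurable_funTS; apply: emeasurable_funM => //.
    exact/measurable_EFinP.
  apply: filterS weight_fin_nu => z wz _.
  by rewrite /D muleA/= posteriorE.
rewrite ge0_integral_pushforward//.
- by apply/measurable_EFinP; exact: measurable_funTS.
- by move=> z _; rewrite lee_fin posterior_ge0.
Qed.

(** Events on [rho \o Z] are particular events on [Z], so the identity for [Z] is applied to
    preimages under [rho]. *)
Lemma cond_prob_posterior_red C : measurable C ->
  is_cond_prob P (rho \o Z) (Y @^-1` C) (posterior C).
Proof.
move=> mC; split; first exact: measurable_posterior.
move=> B mB; have [_ gE] := cond_prob_posterior mC.
apply: (gE (rho @^-1` B)).
by rewrite -[_ @^-1` _]setTI; exact: mrho.
Qed.

Lemma factorization_sufficient : sufficient_reduction P Y Z rho.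
Proof.
split=> // C mC; exists (posterior C \o rho), (posterior C); split.
- exact: cond_prob_posterior.
- exact: cond_prob_posterior_red.
- by apply: aeW => w.
Qed.

End factorized_density.

(** * Uniqueness of conditional probabilities, subspaces and means *)

Lemma cond_prob_unique d dW (Omega : measurableType d) (R : realType)
    (P : probability Omega R) (TW : measurableType dW) (W : {RV P >-> TW})
    (E : set Omega) (g1 g2 : TW -> R) : measurable E ->
  is_cond_prob P W E g1 -> is_cond_prob P W E g2 ->
  {ae P, forall w, g1 (W w) = g2 (W w)}.
Proof.
move=> mE.
have H g : is_cond_prob P W E g -> P.-integrable setT (EFin \o g \o W).
  move=> [mg gE]; have mgW : measurable_fun setT (EFin \o g \o W).
    by apply/measurable_EFinP; exact: measurableT_comp.
  (* Finiteness comes from the defining identity on the whole space, where the integral is a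
     probability. *)
  apply/integrableP; split => //; apply/abse_integralP => //.
  have := gE setT measurableT; rewrite preimage_setT setIT => <-.
  rewrite gee0_abs// (le_lt_trans (probability_le1 P _))//; first exact: ltry.
have L g B : is_cond_prob P W E g -> measurable B ->
    (\int[distribution P W]_(z in B) (g z)%:E = P (E `&` W @^-1` B))%E.
  move=> cg mB; have [mg ->//] := cg.
  rewrite integral_pushforward//; first exact/measurable_EFinP.
  apply: integrableS (H _ cg) => //.
  by rewrite -[_ @^-1` _]setTI; exact: measurable_funPT.
move=> c1 c2; have [m1 _] := c1; have [m2 _] := c2.
apply: (@ae_preimage _ _ _ _ _ _ W (fun z => g1 z = g2 z)).
have : ae_eq (distribution P W) setT (EFin \o g1) (EFin \o g2).
  apply: integral_ae_eq => //.
  - apply: integrable_pushforward => //; first exact/measurable_EFinP.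
    by rewrite preimage_setT; exact: H.
  - exact/measurable_EFinP.
  - by move=> B _ mB; rewrite /= !L.
by apply: filterS => z /(_ I)/= [].
Qed.

(** Take a subspace of maximal dimension inside [L]: adjoining the line of any [v] in [L] stays
    inside [L], so it cannot raise the dimension. *)
Lemma vspace_of_closed (F : fieldType) (vT : vectType F) (L : vT -> Prop) :
  L 0 -> (forall a u v, L u -> L v -> L (a *: u + v)) ->
  exists V : {vspace vT}, forall v, v \in V <-> L v.
Proof.
move=> L0 LP.
pose Q n := `[< exists V : {vspace vT}, \dim V = n /\ forall v, v \in V -> L v >].
have Q0 : exists n, Q n.
  exists 0%N; apply/asboolP; exists 0%VS; split; first exact: dimv0.
  by move=> v; rewrite memv0 => /eqP ->.
have Qle n : Q n -> (n <= \dim {: vT})%N.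
  by move=> /asboolP[V [<- _]]; exact/dimvS/subvf.
case: (ex_maxnP Q0 Qle) => n /asboolP[V [dV VL]] nmax.
exists V => v; split; first exact: VL.
move=> Lv; have dle : (\dim (V + <[v]>)%VS <= \dim V)%N.
  rewrite dV; apply: nmax; apply/asboolP; exists (V + <[v]>)%VS; split => //.
  move=> _ /memv_addP[u uV [_ /vlineP[a ->] ->]].
  by rewrite addrC; apply: LP => //; exact: VL.
have : (V == V + <[v]>)%VS by rewrite eqEdim addvSl.
by move=> /eqP ->; exact/(subvP (addvSr _ _))/memv_line.
Qed.

Section means.
Context d (Omega : measurableType d) (R : realType) (P : probability Omega R).

Lemma mean_affine m n (M : 'M[R]_(m, n)) (c : 'cV[R]_m) (W : Omega -> 'cV[R]_n) :
  has_mean P W -> has_mean P (fun w => M *m W w + c) /\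
  mean P (fun w => M *m W w + c) = M *m mean P W + c.
Proof.
move=> iW.
have E i w : ((M *m W w + c) i 0)%:E =
    ((\sum_j (M i j)%:E * (W w j 0)%:E) + (c i 0)%:E)%E.
  rewrite !mxE EFinD; congr (_ + _)%E; rewrite -sumEFin.
  by apply: eq_bigr => j _; rewrite EFinM.
have iMW i j : P.-integrable setT (fun w => (M i j)%:E * (W w j 0)%:E)%E.
  by apply: integrableZl.
have iS i : P.-integrable setT (fun w => \sum_j (M i j)%:E * (W w j 0)%:E)%E.
  by apply: integrable_sum => // j _; exact: iMW.
have ic i : P.-integrable setT (fun=> (c i 0)%:E).
  by apply: finite_measure_integrable_cst.
split.
  move=> i; under eq_fun do rewrite E.
  exact: integrableD.
apply/matrixP => i k; rewrite ord1 {k} mxE unlock.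
under eq_integral do rewrite E.
rewrite integralD//= integral_cst//= probability_setT mule1.
rewrite integral_sum//.
rewrite (eq_bigr (fun j => (M i j * fine 'E_P[fun w => W w j 0])%:E)); last first.
  move=> j _; rewrite unlock integralZl// EFinM fineK//.
  exact: integrable_fin_num.
by rewrite sumEFin -EFinD !mxE; congr (_ + _); apply: eq_bigr => j _; rewrite mxE.
Qed.

(** The matrix [M] of the projection onto [V] fixes [W - c] almost surely. Means commute with affine
    maps, so [M] also fixes [mean P W - c], which therefore lies in [V]. *)
Lemma mean_in_vspace n (c : 'cV[R]_n) (W : Omega -> 'cV[R]_n)
    (V : {vspace 'cV[R]_n}) :
  has_mean P W -> {ae P, forall w, W w - c \in V} -> mean P W - c \in V.
Proof.
move=> iW aeV.
pose M : 'M[R]_n := \matrix_(i, j) projv V (delta_mx j 0) i 0.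
have ME v : M *m v = projv V v.
  rewrite {2}[v]matrix_sum_delta linear_sum/=; apply/matrixP => i k.
  rewrite ord1 {k} mxE summxE; apply: eq_bigr => j _.
  by rewrite big_ord1 linearZ/= !mxE mulrC.
have [_ mE] := mean_affine (M - 1%:M) (- ((M - 1%:M) *m c)) iW.
have : mean P (fun w => (M - 1%:M) *m W w - (M - 1%:M) *m c) = 0.
  apply/matrixP => i k; rewrite ord1 {k} !mxE unlock.
  rewrite (ae_eq_integral (cst 0%E)) ?integral0//.
    have [+ _] := mean_affine (M - 1%:M) (- ((M - 1%:M) *m c)) iW.
    by move=> /(_ i) /measurable_int.
  apply: filterS aeV => w Vw _.
  by rewrite -mulmxBr mulmxBl ME mul1mx projv_id// subrr mxE.
rewrite mE -mulmxBr mulmxBl ME mul1mx => /eqP; rewrite subr_eq0 => /eqP <-.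
exact: memv_proj.
Qed.

End means.

Lemma measurable_dot d (T : measurableType d) (R : realType) s
    (U V : T -> 'cV[R]_s) :
  measurable_fun setT U -> measurable_fun setT V ->
  measurable_fun setT (fun t => ((U t)^T *m V t) 0 0).
Proof.
move=> mU mV; rewrite (_ : (fun _ => _) = (fun t => \sum_i U t i 0 * V t i 0)).
  apply: measurable_sum => i; apply: measurable_funM.
    exact: measurableT_comp (measurable_mx_entry _ _) mU.
  exact: measurableT_comp (measurable_mx_entry _ _) mV.
by apply/funext => t; rewrite mxE; apply: eq_bigr => i _; rewrite mxE.
Qed.

(** * Countable partitions of the parameter space by grids *)

Section grid_cells.
Context d (T : measurableType d) (R : realType) (s : nat) (c : T -> 'cV[R]_s).
Hypothesis mc : measurable_fun setT c.

(* Grid cells stand in for balls: being countably many, those of measure zero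
   can be discarded at once, without discussing topological supports. *)
Definition gridpoint (n : nat) (y : T) : 'cV[int]_s :=
  \col_i Num.floor (n.+1%:R * c y i 0).

Definition gridcell n k : set T := [set y | gridpoint n y = k].

Lemma measurable_gridcell n k : measurable (gridcell n k).
Proof.
rewrite (_ : gridcell n k = \bigcap_(i in [set: 'I_s])
   ((fun y => n.+1%:R * c y i 0) @^-1` `[(k i 0)%:~R, (k i 0 + 1)%:~R[)).
  apply: fin_bigcap_measurable => // i _.
  rewrite -[X in measurable X]setTI; apply: measurable_funM => //.
  exact: measurableT_comp (measurable_mx_entry _ _) mc.
apply/seteqP; split => y /=.
  move=> <- i _ /=; rewrite mxE in_itv/=; exact: floor_itv.
move=> yk; apply/matrixP => i j; rewrite ord1 {j} mxE; apply/eqP.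
by rewrite floor_eq; have := yk i I; rewrite /= in_itv.
Qed.

(** Scaled by [n.+1], the two coordinates have the same floor, so they differ by less than 1. *)
Lemma gridcell_dist n y y' i : gridcell n (gridpoint n y) y' ->
  `|c y' i 0 - c y i 0| <= n.+1%:R^-1.
Proof.
move=> /matrixP/(_ i 0); rewrite !mxE => e.
have /andP[a1 a2] := floor_itv (n.+1%:R * c y' i 0).
have /andP[b1 b2] := floor_itv (n.+1%:R * c y i 0).
rewrite e in a1 a2.
rewrite -[leLHS](mulKf (lt0r_neq0 (ltr0Sn R n))) ler_piMr//.
rewrite -[X in X * _]ger0_norm// -normrM mulrBr ler_norml.
rewrite intrD1 in a2 b2.
apply/andP; split; lra.
Qed.

End grid_cells.

(** * Elementary inequalities, measurable limits and dot products *)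

Section real_arithmetic.
Context (R : realFieldType).

Lemma ler_subD_cross (x w N1 N2 A : R) : x <= A + w -> x - N1 - (w - N2) <= A - N1 + N2.
Proof. by move=> ?; lra. Qed.

(** [x1], [x2] stand for the log-posteriors of a cell at [t] and [t0], [x3], [x4] for those of the
    reference cell; [A], [A0] for the dot products, [D] for the cell error, and [N], [N0] for the
    log total weights, which cancel. *)
Lemma ler_sub_squeeze (D A A0 N N0 x1 x2 x3 x4 : R) : x4 - x3 <= - A0 + D - N0 + N ->
    x3 - x4 <= A0 + D - N + N0 -> x2 - x1 <= - A + D - N0 + N ->
    x1 - x2 <= A + D - N + N0 ->
    A - A0 - 2 * D <= x1 - x2 - (x3 - x4) <= A - A0 + 2 * D.
Proof. by move=> *; apply/andP; split; lra. Qed.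

End real_arithmetic.

Lemma ln_le_expRM (R : realType) (x w a : R) : 0 < x -> 0 < w ->
  x <= expR a * w -> ln x <= a + ln w.
Proof.
move=> x0 w0 le; rewrite -[a]expRK -lnM ?posrE ?expR_gt0//.
by rewrite ler_ln ?posrE ?mulr_gt0 ?expR_gt0.
Qed.

(** The upper limit is measurable everywhere and equals the limit wherever there is one. Thus an
    almost sure limit of functions of a reduction is again a measurable function of it. *)
Lemma measurable_limit d (T : measurableType d) (R : realType)
    (u : nat -> T -> R) : (forall n, measurable_fun setT (u n)) ->
  exists2 phi : T -> R, measurable_fun setT phi &
    forall x l, u ^~ x @ \oo --> l -> phi x = l.
Proof.
move=> mu; exists (fun x => fine (limn_esup (fun n => (u n x)%:E))).
  apply: measurableT_comp => //.
  apply: (@measurable_fun_limn_esup _ _ _ _ (fun n x => (u n x)%:E)) => n.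
  exact/measurable_EFinP.
move=> x l ul; have ul' : (fun n => (u n x)%:E) @ \oo --> l%:E.
  by apply: cvg_EFin => //; exact: nearW.
by have [_ ->] := cvg_limn_einf_sup ul'.
Qed.

Section dot_product.
Context (R : comRingType) (s : nat).
Implicit Types u v : 'cV[R]_s.

Lemma dotBl u u' v :
  ((u - u')^T *m v) 0 0 = (u^T *m v) 0 0 - (u'^T *m v) 0 0.
Proof. by rewrite raddfB mulmxBl [LHS]mxE [X in _ + X]mxE. Qed.

Lemma dotBr u v v' :
  (u^T *m (v - v')) 0 0 = (u^T *m v) 0 0 - (u^T *m v') 0 0.
Proof. by rewrite mulmxBr [LHS]mxE [X in _ + X]mxE. Qed.

Lemma dotC u v : (u^T *m v) 0 0 = (v^T *m u) 0 0.
Proof. by rewrite -[v in LHS]trmxK -trmx_mul mxE. Qed.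

Lemma dotNr u v : (u^T *m - v) 0 0 = - (u^T *m v) 0 0.
Proof. by rewrite mulmxN mxE. Qed.

End dot_product.

(** * Minimality for a nondegenerate exponential family *)

Section exponential_family.
Context d dY dZ (Omega : measurableType d) (R : realType)
  (P : probability Omega R) (TY : measurableType dY) (TZ : measurableType dZ)
  (s : nat) (Y : {RV P >-> TY}) (Z : {RV P >-> TZ}).
Variables (nu : {sigma_finite_measure set TZ -> \bar R}).
Variables (h0 : TZ -> R) (b : TY -> R) (c : TY -> 'cV[R]_s) (rho : TZ -> 'cV[R]_s).
Hypotheses (mh0 : measurable_fun setT h0) (h0_gt0 : forall z, 0 < h0 z).
Hypotheses (mb : measurable_fun setT b) (b_gt0 : forall y, 0 < b y).
Hypotheses (mc : measurable_fun setT c) (mrho : measurable_fun setT rho).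
Hypothesis joint : forall C B, measurable C -> measurable B ->
  P (Y @^-1` C `&` Z @^-1` B) =
  (\int[distribution P Y]_(y in C) \int[nu]_(z in B)
     (h0 z * (b y * expR (((c y)^T *m rho z) 0 0)))%:E)%E.
Hypotheses (ic : has_mean P (c \o Y)) (c0 : mean P (c \o Y) = 0).
Hypothesis nondegenerate : forall V : {vspace 'cV[R]_s},
  {ae P, forall w, c (Y w) \in V} -> V = fullv.

Let K (u : TY * 'cV[R]_s) : R := b u.1 * expR (((c u.1)^T *m u.2) 0 0).

Let mK : measurable_fun setT K.
Proof.
apply: measurable_funM; first exact: measurableT_comp.
apply: measurableT_comp => //; apply: measurable_dot => //.
exact: measurableT_comp.
Qed.

Let K_gt0 u : 0 < K u.
Proof. by rewrite mulr_gt0// expR_gt0. Qed.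

Let wgt := weight Y K.
Let post := posterior Y K.

Let dist1 (t t0 : 'cV[R]_s) := \sum_i `|t i 0 - t0 i 0|.

Let cell n y := gridcell c n (gridpoint c n y).

Let mcell n y : measurable (cell n y).
Proof. exact: measurable_gridcell. Qed.

(** Each coordinate of [c] varies by at most [1 / n.+1] within a cell, and [dist1] is the norm dual
    to this coordinatewise bound. *)
Lemma dot_cell n y y' t t0 : cell n y y' ->
  ((c y')^T *m (t - t0)) 0 0 <=
  ((c y)^T *m (t - t0)) 0 0 + dist1 t t0 / n.+1%:R.
Proof.
move=> yy'; have -> : ((c y')^T *m (t - t0)) 0 0 =
    ((c y)^T *m (t - t0)) 0 0 + ((c y' - c y)^T *m (t - t0)) 0 0.
  by rewrite dotBl [RHS]addrC subrK.
rewrite lerD2l mxE mulr_suml ler_sum// => i _.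
rewrite (le_trans (ler_norm _))// normrM mulrC !mxE ler_wpM2l//.
exact: gridcell_dist.
Qed.

(* Comparing [t] with a reference point [t0] cancels the unknown mass of the
   cell. *)
Lemma weight_cell_le n y t t0 :
  (wgt (cell n y) t <=
   (expR (((c y)^T *m (t - t0)) 0 0 + dist1 t t0 / n.+1%:R))%:E *
   wgt (cell n y) t0)%E.
Proof.
rewrite /wgt /weight -ge0_integralZl//; last 2 first.
- by apply: measurable_funTS; exact: measurable_K1.
- by move=> y' _; rewrite lee_fin ltW.
apply: ge0_le_integral => //.
- by move=> y' _; rewrite lee_fin ltW.
- by apply: measurable_funTS; exact: measurable_K1.
- apply: measurable_funTS; apply: emeasurable_funM => //.
  exact: measurable_K1.
move=> y' yy'; rewrite -EFinM lee_fin /K/= mulrCA ler_pM2l// -expRD ler_expR.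
have -> : ((c y')^T *m t) 0 0 =
    ((c y')^T *m (t - t0)) 0 0 + ((c y')^T *m t0) 0 0.
  by rewrite dotBr subrK.
by rewrite lerD2r; exact: dot_cell.
Qed.

(** For such [y] the posteriors of the cells around it are positive at every scale, wherever the
    total weight is finite, so their logarithms can be compared. *)
Definition charged y := forall n, (0 < P (Y @^-1` cell n y))%E.

(** There are countably many cells over all scales, so the null ones together form a null event;
    outside it, every cell containing the value of [Y] has positive probability. *)
Lemma ae_charged : {ae P, forall w, charged (Y w)}.
Proof.
(* [m.1] is the scale and [m.2] encodes an integer vector, so pairs of naturals enumerate all
   cells. *)
pose Q (m : nat * nat) w := forall k : 'cV[int]_s, unpickle m.2 = Some k ->
  P (Y @^-1` gridcell c m.1 k) = 0%E -> ~ gridcell c m.1 k (Y w).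
have aeQ n m : {ae P, forall w, Q (n, m) w}.
  case E : (@unpickle 'cV[int]_s m) => [k|]; last first.
    by apply: aeW => w k /=; rewrite E.
  have [P0|P0] := eqVneq (P (Y @^-1` gridcell c n k)) 0%E.
    exists (Y @^-1` gridcell c n k); split => //.
    - rewrite -[X in measurable X]setTI; apply: measurable_funPT => //.
      exact: measurable_gridcell.
    - move=> w /= nQ; apply: contrapT => nk; apply: nQ => k' /=.
      by rewrite E => -[<-] _.
  apply: aeW => w k' /=; rewrite E => -[<-] P0'.
  by rewrite P0' eqxx in P0.
have := @ae_foralln _ _ _ P (fun n w => forall m, Q (n, m) w)
  (fun n => ae_foralln (aeQ n)).
apply: filterS => w Qw n; rewrite lt0e measure_ge0 andbT.
apply/eqP => P0; apply: (Qw n (pickle (gridpoint c n (Y w))) _ _ P0) => //=.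
by rewrite pickleK.
Qed.

Let finite_weight t := wgt setT t \is a fin_num.

Lemma ln_post C t : measurable C -> (0 < P (Y @^-1` C))%E -> finite_weight t ->
  (0 < fine (wgt C t)) /\
  ln (post C t) = ln (fine (wgt C t)) - ln (fine (wgt setT t)).
Proof.
move=> mC PC ft.
have ltoo D : measurable D -> (wgt D t < +oo)%E.
  move=> mD; have := @le_weight _ _ _ _ _ _ _ _ Y K mK K_gt0 D t mD.
  by move=> /le_lt_trans; apply; rewrite -ge0_fin_numE// weight_ge0.
have gt0 D : measurable D -> (0 < P (Y @^-1` D))%E -> 0 < fine (wgt D t).
  by move=> mD PD; rewrite fine_gt0// ltoo// weight_gt0.
split; first exact: gt0.
rewrite ln_div// posrE gt0//.
by rewrite preimage_setT probability_setT.
Qed.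

Let logpost n y t := ln (post (cell n y) t).

Lemma logpost_cell_le n y t t0 : charged y -> finite_weight t -> finite_weight t0 ->
  logpost n y t - logpost n y t0 <=
  ((c y)^T *m (t - t0)) 0 0 + dist1 t t0 / n.+1%:R
  - ln (fine (wgt setT t)) + ln (fine (wgt setT t0)).
Proof.
move=> cy ft ft0.
have [p1 e1] := ln_post (mcell n y) (cy n) ft.
have [p2 e2] := ln_post (mcell n y) (cy n) ft0.
rewrite [logpost n y t]e1 [logpost n y t0]e2.
have fin x : 0 < fine (wgt (cell n y) x) -> wgt (cell n y) x \is a fin_num.
  by case: wgt; rewrite /= ?ltxx.
have := weight_cell_le n y t t0.
rewrite -(fineK (fin _ p1)) -(fineK (fin _ p2)) -EFinM lee_fin.
move=> /(ln_le_expRM p1 p2).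
exact: ler_subD_cross.
Qed.

(** The difference between [t] and [t0] cancels the mass of the cell, and the difference between [y]
    and [y0] cancels the total weights. What is left lies within [2 * dist1 t t0 / n.+1] of the
    limit. *)
Lemma cvg_logpost y y0 t t0 :
  charged y -> charged y0 -> finite_weight t -> finite_weight t0 ->
  (fun n => (logpost n y t - logpost n y t0)
          - (logpost n y0 t - logpost n y0 t0)) @ \oo -->
  ((c y - c y0)^T *m (t - t0)) 0 0.
Proof.
move=> cy cy0 ft ft0; set l := (X in _ --> X).
pose e := 2 * dist1 t t0.
have dist1C : dist1 t0 t = dist1 t t0.
  by apply: eq_bigr => i _; rewrite distrC.
have dotN (u : 'cV[R]_s) : (u^T *m (t0 - t)) 0 0 = - (u^T *m (t - t0)) 0 0 :> R.
  by rewrite -dotNr opprB.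
have lE : l = ((c y)^T *m (t - t0)) 0 0 - ((c y0)^T *m (t - t0)) 0 0.
  exact: dotBl.
apply: (@squeeze_cvgr _ _ _ _ (fun n => l - e * harmonic n)
  (fun n => l + e * harmonic n)).
- apply: nearW => n; rewrite /harmonic/=.
  (* Exchanging [t] and [t0] turns each upper bound into a lower bound. *)
  have := logpost_cell_le n cy ft ft0.
  have := logpost_cell_le n cy ft0 ft.
  have := logpost_cell_le n cy0 ft ft0.
  have := logpost_cell_le n cy0 ft0 ft.
  rewrite !dotN !dist1C lE /e -mulrA.
  exact: ler_sub_squeeze.
- rewrite -[X in _ --> X]subr0 -(mulr0 e); apply: cvgB; first exact: cvg_cst.
  by apply: cvgM; [exact: cvg_cst|exact: cvg_harmonic].
- rewrite -[X in _ --> X]addr0 -(mulr0 e); apply: cvgD; first exact: cvg_cst.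
  by apply: cvgM; [exact: cvg_cst|exact: cvg_harmonic].
Qed.

Lemma expfam_minimal_sufficient : minimal_sufficient_reduction P Y Z rho.
Proof.
have jointK C B : measurable C -> measurable B ->
  P (Y @^-1` C `&` Z @^-1` B) =
  (\int[distribution P Y]_(y in C) \int[nu]_(z in B)
     (h0 z * K (y, rho z))%:E)%E by exact: joint.
split; first exact: (factorization_sufficient mh0 h0_gt0 mK K_gt0 mrho jointK).
move=> dT' T' rho' [mrho' suff'].
(* By uniqueness, the version of the conditional probability that factors through [rho'] agrees
   almost surely with the explicit posterior. *)
have post_rho' C : measurable C -> exists k : T' -> R, measurable_fun setT k /\
    {ae P, forall w, post C (rho (Z w)) = k (rho' (Z w))}.
  move=> mC; have [g [k [cg [mk _] gk]]] := suff' C mC.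
  exists k; split => //.
  have cpost := cond_prob_posterior mh0 h0_gt0 mK K_gt0 mrho jointK mC.
  have mYC : measurable (Y @^-1` C).
    by rewrite -[X in measurable X]setTI; exact: measurable_funPT.
  apply: filterS2 (cond_prob_unique mYC cpost cg) gk => w /= e1 e2.
  exact: etrans e1 e2.
pose L (v : 'cV[R]_s) := exists2 phi : T' -> R, measurable_fun setT phi &
  {ae P, forall w, (v^T *m rho (Z w)) 0 0 = phi (rho' (Z w))}.
have [V VL] : exists V : {vspace 'cV[R]_s}, forall v, v \in V <-> L v.
  apply: vspace_of_closed.
    by exists (cst 0) => //; apply: aeW => w; rewrite trmx0 mul0mx mxE.
  move=> a u v [phi mphi uphi] [chi mchi vchi].
  exists (fun x => a * phi x + chi x).
    by apply: measurable_funD => //; exact: measurable_funM.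
  apply: filterS2 uphi vchi => w <- <-.
  by rewrite linearP/= mulmxDl -scalemxAl [LHS]mxE [X in X + _]mxE.
have aef : {ae P, forall w, finite_weight (rho (Z w))}.
  exact: (ae_weight_fin mh0 h0_gt0 mK K_gt0 mrho jointK).
(* One sample point supplies both the base parameter [y0] and the reference value [t0]; it exists
   because an almost sure event is nonempty. *)
have [w0 [cy0 ft0]] :
    exists w, charged (Y w) /\ finite_weight (rho (Z w)).
  have H : {ae P, forall w, charged (Y w) /\ finite_weight (rho (Z w))}.
    by apply: filterS2 ae_charged aef => w.
  have PF : ProperFilter (almost_everywhere P).
    apply: ae_properfilter_algebraOfSetsType.
    by rewrite [ltRHS]probability_setT.
  exact: (@filter_ex _ _ PF _ H).
set y0 := Y w0 in cy0; set t0 := rho (Z w0) in ft0.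
have diffV y : charged y -> c y - c y0 \in V.
  move=> cy; apply/VL.
  have [k kP] := choice (fun n => post_rho' _ (mcell n y)).
  have [k0 k0P] := choice (fun n => post_rho' _ (mcell n y0)).
  (* The posteriors at [rho (Z w)] are replaced by their versions through [rho']; the terms at the
     fixed [t0] are constants. *)
  pose u n x := (ln (k n x) - logpost n y t0) - (ln (k0 n x) - logpost n y0 t0).
  have mu n : measurable_fun setT (u n).
    have [mk _] := kP n; have [mk0 _] := k0P n.
    by do !apply: measurable_funB => //; exact: measurableT_comp.
  have [phi mphi phiP] := measurable_limit mu.
  (* The limit only gives the pairing with [rho (Z w) - t0]; the added constant restores the pairing
     with [rho (Z w)]. *)
  exists (fun x => phi x + ((c y - c y0)^T *m t0) 0 0).
    exact: measurable_funD.
  have aek := ae_foralln (fun n => (kP n).2).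
  have aek0 := ae_foralln (fun n => (k0P n).2).
  apply: filterS3 aef aek aek0 => w fw kw k0w.
  rewrite (phiP _ (((c y - c y0)^T *m (rho (Z w) - t0)) 0 0)).
    by rewrite [in RHS]dotBr subrK.
  under eq_fun do rewrite /u -kw -k0w.
  exact: cvg_logpost.
have aeV : {ae P, forall w, c (Y w) - c y0 \in V}.
  by apply: filterS ae_charged => w /diffV.
(* Since [c \o Y] has mean zero, [- c y0] is the mean of the differences [c (Y w) - c y0], which lie
   in [V] almost surely. *)
have y0V : c y0 \in V.
  by rewrite -memvN -[- _]add0r -c0; exact: mean_in_vspace.
have Vfull : V = fullv.
  apply: nondegenerate; apply: filterS aeV => w /(memvD y0V).
  by rewrite addrC subrK.
have coord i : L (delta_mx i 0) by apply/VL; rewrite Vfull memvf.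
have coord' i : exists phi : T' -> R, measurable_fun setT phi /\
    {ae P, forall w, rho (Z w) i 0 = phi (rho' (Z w))}.
  have [phi mphi aephi] := coord i; exists phi; split => //.
  apply: filterS aephi => w <-; rewrite trmx_delta mxE (bigD1 i)//= big1.
    by rewrite mxE !eqxx mul1r addr0.
  by move=> j /negPf ji; rewrite mxE ji andbF mul0r.
have [phi phiP] := choice coord'.
exists (fun x => \col_i phi i x).
  apply: measurable_fun_mx => i j; under eq_fun do rewrite mxE.
  by have [] := phiP i.
(* The quantifier over coordinates passes through the naturals, where countable intersections of
   almost sure events apply; indices [n >= s] are vacuous. *)
have : {ae P, forall w, forall (n : nat) (i : 'I_s), n = i ->
    rho (Z w) i 0 = phi i (rho' (Z w))}.
  apply: ae_foralln => n; have [ns|sn] := ltnP n s.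
    have [_] := phiP (Ordinal ns); apply: filterS => w e i ni.
    by rewrite (_ : i = Ordinal ns)//; exact: val_inj.
  by apply: aeW => w i ni; move: sn; rewrite ni leqNgt ltn_ord.
apply: filterS => w e; apply/matrixP => i j; rewrite ord1 mxE.
exact: e.
Qed.

End exponential_family.

(** * The reference measure: Lebesgue times counting *)

Lemma measurable_cV_bool q (A : set 'cV[bool]_q) : measurable A.
Proof.
have m1 (h : 'cV[bool]_q) : measurable [set h].
  rewrite (_ : [set h] = \bigcap_(i in [set: 'I_q])
      ((fun M : 'cV[bool]_q => M i 0) @^-1` [set h i 0])).
    apply: fin_bigcap_measurable => // i _.
    by rewrite -[X in measurable X]setTI; exact: measurable_mx_entry.
  apply/seteqP; split => [_ -> i _ //|g /= gh].
  by apply/matrixP => i j; rewrite ord1; exact: gh.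
rewrite (_ : A = \bigcup_(h in A) [set h]); last first.
  by apply/seteqP; split => [h Ah|_ [h Ah ->]//]; exists h.
by apply: fin_bigcup_measurable.
Qed.

Section reference_measure.
Context {R : realType}.

Lemma lebesgue_cV_sigma_finite n :
  sigma_finite setT (lebesgue_cV n : set 'cV[R]_n -> \bar R).
Proof.
exists (fun k => [set v : 'cV[R]_n | forall i, `[- k%:R, k%:R]%classic (v i 0)]).
  apply/seteqP; split => // v _.
  (* This integer exceeds the sum of the absolute coordinates, hence each of them. *)
  exists (Num.truncn (\sum_i `|v i 0|)).+1 => // i /=.
  rewrite in_itv/= -ler_norml (le_trans _ (ltW (truncnS_gt _)))//.
  by rewrite (bigD1 i)//= lerDl sumr_ge0.
move=> k; split; last first.
  rewrite (@lebesgue_cV_box _ _ (fun=> `[- k%:R, k%:R]%classic))//.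
  rewrite -ge0_fin_numE ?prode_ge0//.
  apply: prode_fin_num => i _; rewrite lebesgue_measure_itv/=.
  by case: ifP => // _; rewrite -EFinB.
rewrite (_ : mkset _ =
    \bigcap_(i in [set: 'I_n]) ((fun v : 'cV[R]_n => v i 0) @^-1` `[- k%:R, k%:R])).
  apply: fin_bigcap_measurable => // i _.
  by rewrite -[X in measurable X]setTI; exact: measurable_mx_entry.
by apply/seteqP; split => v /= h i => [_|]; apply: h.
Qed.

(** A set function with its own name, on which the sigma-finite structure can be declared. *)
Definition volume_cV n : set 'cV[R]_n -> \bar R := lebesgue_cV n.

HB.instance Definition _ n := Measure.copy (@volume_cV n) (lebesgue_cV n).

HB.instance Definition _ n := Measure_isSigmaFinite.Build _ _ _ (@volume_cV n)
  (lebesgue_cV_sigma_finite n).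

Variable q : nat.

(** Unit masses along an enumeration of the binary vectors. The default of [nth] is never reached,
    since only the first [#|'cV[bool]_q|] terms are summed. *)
Let atoms : {measure set 'cV[bool]_q -> \bar R}^nat :=
  fun k => \d_(nth (const_mx false) (enum 'cV[bool]_q) k).

Definition counting_cV := msum atoms #|'cV[bool]_q|.

HB.instance Definition _ := Measure.on counting_cV.

Let count_sigma_finite : sigma_finite setT counting_cV.
Proof.
exists (fun=> setT); first by rewrite bigcup_const.
move=> _; split => //; apply/lte_sum_pinfty => k _.
by rewrite /atoms/= diracT ltry.
Qed.

HB.instance Definition _ :=
  Measure_isSigmaFinite.Build _ _ _ counting_cV count_sigma_finite.

Lemma integral_counting_cV (g : 'cV[bool]_q -> \bar R) :
  (forall h, 0 <= g h)%E ->
  (\int[counting_cV]_h g h = \sum_(h : 'cV[bool]_q) g h)%E.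
Proof.
move=> g0; have mg : measurable_fun setT g.
  by move=> _ B mB; exact: measurable_cV_bool.
rewrite ge0_integral_measure_sum// cardT.
under eq_bigr do rewrite integral_dirac// diracT mul1e.
transitivity (\sum_(h <- enum 'cV[bool]_q) g h)%E; last by rewrite big_enum.
by rewrite (big_nth (const_mx false)) big_mkord.
Qed.

End reference_measure.

Section reference_integral.
Context {R : realType} (p q : nat).

Definition mixed_measure := (@volume_cV R p \x @counting_cV R q)%E.

HB.instance Definition _ := Measure.on mixed_measure.

Let mixed_measure_sigma_finite : sigma_finite setT mixed_measure.
Proof.
have [F TF Foo] := sigma_finiteT (@volume_cV R p).
exists (fun k => F k `*` setT); first by rewrite -setX_bigcupl -TF setXTT.
move=> k; have [mF Fk] := Foo k; split; first exact: measurableX.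
rewrite [ltLHS]product_measure1E// lte_mul_pinfty//.
  by rewrite ge0_fin_numE.
by apply/lte_sum_pinfty => i _; rewrite /= diracT ltry.
Qed.

HB.instance Definition _ :=
  Measure_isSigmaFinite.Build _ _ _ mixed_measure mixed_measure_sigma_finite.

(** Tonelli with the counting integral outside, where it becomes a finite sum. *)
Lemma integral_mixed (B : set ('cV[R]_p * 'cV[bool]_q))
    (g : 'cV[R]_p * 'cV[bool]_q -> \bar R) :
  measurable B -> measurable_fun setT g -> (forall z, 0 <= g z)%E ->
  (\int[mixed_measure]_(z in B) g z =
   \sum_(h : 'cV[bool]_q) \int[lebesgue_cV p]_(x in [set x | B (x, h)]) g (x, h))%E.
Proof.
move=> mB mg g0.
have mgB : measurable_fun setT (g \_ B).
  by apply/(measurable_restrictT _ _).1 => //; exact: measurable_funTS.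
have gB0 z : (0 <= (g \_ B) z)%E by apply: erestrict_ge0.
rewrite integral_mkcond [LHS]fubini_tonelli2// integral_counting_cV; last first.
  by move=> h; exact: integral_ge0.
apply: eq_bigr => h _; rewrite [RHS]integral_mkcond.
by apply: eq_integral => x _; rewrite !patchE.
Qed.

End reference_integral.

(** * Measurability of matrix operations and of the mixed family *)

Section measurable_matrix_operations.
Context d (T : measurableType d) (R : realType).

Lemma measurable_mxP m n (M : T -> 'M[R]_(m, n)) :
  measurable_fun setT M <-> forall i j, measurable_fun setT (fun t => M t i j).
Proof.
split => [mM i j|]; last exact: measurable_fun_mx.
exact: measurableT_comp (measurable_mx_entry i j) mM.
Qed.

Lemma measurable_col_mx m1 m2 n (A : T -> 'M[R]_(m1, n)) (B : T -> 'M[R]_(m2, n)) :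
  measurable_fun setT A -> measurable_fun setT B ->
  measurable_fun setT (fun t => col_mx (A t) (B t)).
Proof.
move=> /measurable_mxP mA /measurable_mxP mB; apply/measurable_mxP => i j.
case: (split_ordP i) => k ->.
  by under eq_fun do rewrite col_mxEu; exact: mA.
by under eq_fun do rewrite col_mxEd; exact: mB.
Qed.

Lemma measurable_mulmx m n k (A : T -> 'M[R]_(m, n)) (B : T -> 'M[R]_(n, k)) :
  measurable_fun setT A -> measurable_fun setT B ->
  measurable_fun setT (fun t => A t *m B t).
Proof.
move=> /measurable_mxP mA /measurable_mxP mB; apply/measurable_mxP => i j.
under eq_fun do rewrite mxE; apply: measurable_sum => l.
exact: measurable_funM.
Qed.

Lemma measurable_addmx m n (A B : T -> 'M[R]_(m, n)) :
  measurable_fun setT A -> measurable_fun setT B ->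
  measurable_fun setT (fun t => A t + B t).
Proof.
move=> /measurable_mxP mA /measurable_mxP mB; apply/measurable_mxP => i j.
by under eq_fun do rewrite mxE; exact: measurable_funD.
Qed.

Lemma measurable_scalemx m n a (A : T -> 'M[R]_(m, n)) :
  measurable_fun setT A -> measurable_fun setT (fun t => a *: A t).
Proof.
move=> /measurable_mxP mA; apply/measurable_mxP => i j.
by under eq_fun do rewrite mxE; exact: measurable_funM.
Qed.

Lemma measurable_trmx m n (A : T -> 'M[R]_(m, n)) :
  measurable_fun setT A -> measurable_fun setT (fun t => (A t)^T).
Proof.
move=> /measurable_mxP mA; apply/measurable_mxP => i j.
by under eq_fun do rewrite mxE; exact: mA.
Qed.

Lemma measurable_vec m n (A : T -> 'M[R]_(m, n)) :
  measurable_fun setT A -> measurable_fun setT (fun t => vec (A t)).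
Proof.
move=> /measurable_trmx/measurable_mxP mA; apply/measurable_mxP => i j.
under eq_fun do rewrite mxE; rewrite (ord1 j).
by case/mxvec_indexP: i => k l; under eq_fun do rewrite mxvecE; exact: mA.
Qed.

Lemma measurable_vech n (A : T -> 'M[R]_n) :
  measurable_fun setT A -> measurable_fun setT (fun t => vech (A t)).
Proof.
move=> /measurable_mxP mA; apply/measurable_mxP => i j.
by under eq_fun do rewrite mxE; exact: mA.
Qed.

End measurable_matrix_operations.

Section mixed_family_measurability.
Context {R : realType} (p q : nat).
Local Notation TZ := ('cV[R]_p * 'cV[bool]_q)%type.

Lemma measurable_suffstat :
  measurable_fun setT (fun z : TZ => suffstat z.1 z.2 : 'cV[R]_(sdim p q)).
Proof.
have mx : measurable_fun setT (fun z : TZ => z.1) by exact: measurable_fst.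
have mh : measurable_fun setT (fun z : TZ => boolcV z.2 : 'cV[R]_q).
  apply: measurableT_comp => // _ B _; exact: measurable_cV_bool.
apply: measurable_col_mx => //; apply: measurable_col_mx => //.
apply: measurable_col_mx.
  apply: measurable_scalemx; apply: measurable_mulmx => //.
  by apply: measurable_vech; apply: measurable_mulmx => //; exact: measurable_trmx.
apply: measurable_col_mx.
  by apply: measurable_vec; apply: measurable_mulmx => //; exact: measurable_trmx.
apply: measurable_mulmx => //.
by apply: measurable_vech; apply: measurable_mulmx => //; exact: measurable_trmx.
Qed.

(** Under the logarithm stands a finite sum of integrals over [x], each measurable in the parameter
    by Tonelli. *)
Lemma measurable_log_partition :
  measurable_fun setT (@log_partition R p q).
Proof.
apply: (measurableT_comp (@measurable_ln R)); apply: measurableT_comp => //.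
apply: emeasurable_sum => h.
pose F (u : 'cV[R]_(sdim p q) * 'cV[R]_p) : \bar R := (unnorm_density u.1 u.2 h)%:E.
apply: (@measurable_fun_fubini_tonelli_F _ _ _ _ _ (@volume_cV R p) F).
  apply/measurable_EFinP; apply: measurable_funM => //.
  apply: measurableT_comp => //; apply: measurable_dot => //.
  have mh : measurable_fun setT
      (fun u : 'cV[R]_(sdim p q) * 'cV[R]_p => (u.2, h)).
    exact: measurable_fun_pair.
  exact: (measurableT_comp measurable_suffstat mh).
by move=> u; rewrite lee_fin mulr_ge0 ?powR_ge0 ?expR_ge0.
Qed.

Variable r : nat.
Variables (Delta : 'M[R]_p) (A : 'M[R]_(p, r)) (beta : 'M[R]_(p, q)).
Variables (muX : 'cV[R]_p) (muH : 'cV[R]_q).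
Variables (tau0 : 'cV[R]_(mdim q)) (tau : 'M[R]_(mdim q, r)).

(** Affine dependence on [f] lets the natural parameter inherit measurability and a mean from
    [f]. *)
Lemma natparam_affine : exists M : 'M[R]_(sdim p q, r), forall f,
  natparam Delta A beta muX muH tau0 tau f =
  M *m f + natparam Delta A beta muX muH tau0 tau 0.
Proof.
exists (col_mx (invmx Delta *m A)
  (col_mx (diag_sel q *m tau - beta^T *m invmx Delta *m A)
  (col_mx 0 (col_mx 0 (offdiag_sel q *m tau))))) => f.
rewrite /natparam !mul_col_mx !add_col_mx !mulmx0 !addr0 !mul0mx !add0r.
congr (col_mx _ _); first exact: addrC.
congr (col_mx _ _); first exact: addrC.
by congr (col_mx _ (col_mx _ _)); exact: addrC.
Qed.

End mixed_family_measurability.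

(** * Coordinates in a basis, and the minimal reduction of the mixed family *)

Lemma basis_of_cols (F : fieldType) n s (S : {vspace 'cV[F]_n}) (alpha : 'M[F]_(n, s)) :
  basis_of S [seq col j alpha | j <- enum 'I_s] ->
  \dim S = s /\
  exists B : 'M[F]_(s, n), forall v, v \in S -> alpha *m (B *m v) = v.
Proof.
pose X := [tuple col j alpha | j < s].
have -> : [seq col j alpha | j <- enum 'I_s] = X.
  by rewrite /X /= /image_mem.
move=> /andP[/eqP <- freeX]; split; first by rewrite (eqP freeX) size_tuple.
(* The transposed pseudo-inverse recovers coordinates: multiplying by [alpha] undoes it on the
   column space of [alpha]. *)
exists (pinvmx alpha^T)^T => v vX.
have /submxP[u vE] : (v^T <= alpha^T)%MS.
  apply/submxP; exists (\row_j coord X j v).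
  apply: trmx_inj; rewrite trmx_mul !trmxK {1}(coord_span vX).
  apply/matrixP => i k; rewrite ord1 summxE mxE; apply: eq_bigr => j _.
  by rewrite -tnth_nth tnth_mktuple !mxE mulrC.
apply: trmx_inj; rewrite trmx_mul [X in X *m _]trmx_mul trmxK mulmxKpV//; apply/submxP.
by exists u.
Qed.

Lemma ge0_ae_eq_integral_distribution d dY (Omega : measurableType d)
    (R : realType) (P : probability Omega R) (TY : measurableType dY)
    (Y : {RV P >-> TY}) (C : set TY) (g1 g2 : TY -> \bar R) :
  measurable C -> measurable_fun setT g1 -> measurable_fun setT g2 ->
  (forall y, 0 <= g1 y)%E -> (forall y, 0 <= g2 y)%E ->
  {ae P, forall w, g1 (Y w) = g2 (Y w)} ->
  (\int[distribution P Y]_(y in C) g1 y = \int[distribution P Y]_(y in C) g2 y)%E.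
Proof.
move=> mC mg1 mg2 g1_ge0 g2_ge0 g12.
rewrite !ge0_integral_pushforward//; try exact: measurable_funTS.
apply: ge0_ae_eq_integral => //.
- by rewrite -[X in measurable X]setTI; exact: measurable_funPT.
- by apply: measurable_funTS; exact: measurableT_comp.
- by apply: measurable_funTS; exact: measurableT_comp.
- by move=> w _; exact: g1_ge0.
- by move=> w _; exact: g2_ge0.
- by apply: filterS g12 => w e _; exact: e.
Qed.

Theorem theorem1 (R : realType) (d dY : measure_display)
  (Omega : measurableType d) (P : probability Omega R)
  (Yt : measurableType dY) (p q r : nat)
  (Y : {RV P >-> Yt}) (X : {RV P >-> 'cV[R]_p}) (H : {RV P >-> 'cV[bool]_q})
  (f : {mfun Yt >-> 'cV[R]_r})
  (Delta : 'M[R]_p) (A : 'M[R]_(p, r)) (beta : 'M[R]_(p, q))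
  (muX : 'cV[R]_p) (muH : 'cV[R]_q)
  (tau0 : 'cV[R]_(mdim q)) (tau : 'M[R]_(mdim q, r))
  (s : nat) (alpha : 'M[R]_(sdim p q, s))
  (S : {vspace 'cV[R]_(sdim p q)}) :
  let eta := fun y => natparam Delta A beta muX muH tau0 tau (f y) in
  let T := fun w => suffstat (X w) (H w) in
  posdefmx Delta ->
  has_mean P (fun w => f (Y w)) -> mean P (fun w => f (Y w)) = 0 ->
  has_mean P X -> muX = mean P X ->
  has_mean P (fun w => boolcV (H w)) -> muH = mean P (fun w => boolcV (H w)) ->
  has_mean P T ->
  has_cond_density Y X H (fun y => expfam_density (eta y)) ->
  is_ae_span P (fun w => eta (Y w) - mean P (fun w' => eta (Y w'))) S ->
  basis_of S [seq col j alpha | j <- enum 'I_s] ->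
  minimal_sufficient_reduction P Y (fun w => (X w, H w))
    (fun xh => alpha^T *m (suffstat xh.1 xh.2 - mean P T)).
Proof.
move=> eta T _ ifY mfY _ _ _ _ _ dens [aeS minS] basisS.
pose m := mean P (fun w => eta (Y w)).
have [M etaE] := natparam_affine Delta A beta muX muH tau0 tau.
have ieta : has_mean P (fun w => eta (Y w)).
  rewrite /eta; under eq_fun do rewrite etaE.
  by have [] := mean_affine M (natparam Delta A beta muX muH tau0 tau 0) ifY.
have meta : measurable_fun setT eta.
  rewrite /eta; under eq_fun do rewrite etaE.
  by apply: measurable_addmx => //; exact: measurable_mulmx.
have [dimS [B BK]] := basis_of_cols basisS.
(* Coordinates of the centred natural parameter in the basis [alpha], valid when it lies in [S],
   which holds almost surely. *)
pose c y := B *m (eta y - m).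
pose rho (z : 'cV[R]_p * 'cV[bool]_q) := alpha^T *m (suffstat z.1 z.2 - mean P T).
(* The mean [m] goes into the factor [h0], which depends on [z]; the centring of the statistic goes
   into [b], which depends on [y]. *)
pose h0 (z : 'cV[R]_p * 'cV[bool]_q) := expR (((suffstat z.1 z.2)^T *m m) 0 0).
pose b y := (2 * pi) `^ (- (p%:R / 2)) *
  expR (((c y)^T *m (alpha^T *m mean P T)) 0 0 - log_partition (eta y)).
have densE y z : eta y - m \in S -> expfam_density (eta y) z.1 z.2 =
    h0 z * (b y * expR (((c y)^T *m rho z) 0 0)).
  move=> yS; rewrite /expfam_density /h0 /b -[in RHS]mulrA mulrCA -!expRD.
  congr (_ * expR _).
  have -> : ((suffstat z.1 z.2)^T *m eta y) 0 0 =
      ((suffstat z.1 z.2)^T *m m) 0 0 + ((c y)^T *m (alpha^T *m suffstat z.1 z.2)) 0 0.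
    rewrite -[X in _ *m X](subrK m) -(BK _ yS) -/(c y) mulmxDr addrC.
    rewrite [LHS]mxE; congr (_ + _).
    by rewrite dotC trmx_mul mulmxA.
  rewrite /rho mulmxBr dotBr; ring.
have mc : measurable_fun setT c.
  by apply: measurable_mulmx => //; exact: measurable_addmx.
have mrho : measurable_fun setT rho.
  apply: measurable_mulmx => //; apply: measurable_addmx => //.
  exact: measurable_suffstat.
have mh0 : measurable_fun setT h0.
  apply: measurableT_comp => //; apply: measurable_dot => //.
  exact: measurable_suffstat.
have mb : measurable_fun setT b.
  apply: measurable_funM => //; apply: measurableT_comp => //.
  apply: measurable_funB; first exact: measurable_dot.
  exact: (measurableT_comp (@measurable_log_partition R p q) meta).
have b0 y : 0 < b y.
  by rewrite mulr_gt0 ?expR_gt0// powR_gt0// mulr_gt0// pi_gt0.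
have mZ : measurable_fun setT (fun w => (X w, H w)) by exact: measurable_fun_pair.
pose Z : {RV P >-> ('cV[R]_p * 'cV[bool]_q)%type} :=
  HB.pack (fun w => (X w, H w)) (isMeasurableFun.Build _ _ _ _ _ mZ).
have [ic Ec] : has_mean P (c \o Y) /\ mean P (c \o Y) = 0.
  have [i e] := mean_affine B (- (B *m m)) ieta.
  rewrite (_ : c \o Y = fun w => B *m eta (Y w) - B *m m); last first.
    by apply/funext => w; rewrite /c/= mulmxBr.
  by split => //; rewrite e subrr.
(* If [c \o Y] lies almost surely in [V], then the image of [V] under [alpha] contains [S] by
   minimality of [S], and comparing dimensions gives [s <= \dim V]. *)
have cV (V : {vspace 'cV[R]_s}) : {ae P, forall w, c (Y w) \in V} -> V = fullv.
  move=> aeV; pose aV := (linfun (mulmx alpha) @: V)%VS.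
  have /dimvS : (S <= aV)%VS.
    apply: minS; apply: filterS2 aeS aeV => w wS wV.
    rewrite -(BK _ wS) (_ : _ *m _ = linfun (mulmx alpha) (c (Y w))).
      exact: memv_img.
    by rewrite lfunE.
  rewrite dimS => saV; have sV : (s <= \dim V)%N.
    by rewrite (leq_trans saV)// -(limg_ker_dim (linfun (mulmx alpha)) V) leq_addl.
  apply/eqP; rewrite eqEdim subvf/= dimvf.
  by rewrite /dim/= muln1.
apply: (@expfam_minimal_sufficient _ _ _ _ _ P _ _ s Y Z
  (@mixed_measure R p q) h0 b c rho) => //.
  by move=> z; exact: expR_gt0.
move=> C D mC mD.
pose g1 (u : ('cV[R]_p * 'cV[bool]_q) * Yt) : \bar R :=
  (expfam_density (eta u.2) u.1.1 u.1.2)%:E.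
pose g2 (u : ('cV[R]_p * 'cV[bool]_q) * Yt) : \bar R :=
  (h0 u.1 * (b u.2 * expR (((c u.2)^T *m rho u.1) 0 0)))%:E.
have mg1 : measurable_fun setT g1.
  apply/measurable_EFinP; apply: measurable_funM => //.
  apply: measurableT_comp => //; apply: measurable_funB.
    apply: measurable_dot; last exact: measurableT_comp.
    exact: (measurableT_comp (@measurable_suffstat R p q) measurable_fst).
  apply: (measurableT_comp (@measurable_log_partition R p q)).
  exact: measurableT_comp.
have mg2 : measurable_fun setT g2.
  apply/measurable_EFinP; apply: measurable_funM; first exact: measurableT_comp.
  apply: measurable_funM; first exact: measurableT_comp.
  apply: measurableT_comp => //; apply: measurable_dot; exact: measurableT_comp.
have g1_ge0 u : (0 <= g1 u)%E by rewrite lee_fin mulr_ge0 ?powR_ge0 ?expR_ge0.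
have g2_ge0 u : (0 <= g2 u)%E.
  rewrite lee_fin mulr_ge0 ?expR_ge0//.
  by apply: mulr_ge0; [exact: ltW|exact: expR_ge0].
pose G (g : _ * Yt -> \bar R) y := (\int[@mixed_measure R p q]_(z in D) g (z, y))%E.
have mG1 : measurable_fun setT (G g1) by exact: measurable_partial_integral.
have mG2 : measurable_fun setT (G g2) by exact: measurable_partial_integral.
have G1_ge0 y : (0 <= G g1 y)%E by exact: integral_ge0.
have G2_ge0 y : (0 <= G g2 y)%E by exact: integral_ge0.
transitivity (\int[distribution P Y]_(y in C) G g1 y)%E.
  rewrite [LHS](dens C D mC mD); apply: eq_integral => y _.
  have mg1y : measurable_fun setT (fun z => g1 (z, y)).
    by apply: (measurableT_comp mg1); exact: measurable_fun_pair.
  exact: esym (integral_mixed mD mg1y (fun z => g1_ge0 (z, y))).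
(* The factorization is established for [y] with [eta y - m] in [S]; almost every value of [Y] is
   such, so the inner integrals agree almost everywhere under the law of [Y]. *)
apply: (ge0_ae_eq_integral_distribution mC mG1 mG2 G1_ge0 G2_ge0).
apply: filterS aeS => w wS; apply: eq_integral => z _.
by rewrite /g1 /g2/= -densE.
Qed.
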